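(* Let $p\ge 1$ and let $T_p$ be a tree on $p$ nodes. Then $$F_{p-1}=M(I_p)\le M(T_p)\le M(G_1(p-1))=2^{p-1}-p+1.$$
   Context: A DAG with skeleton $G$ (a finite simple undirected graph) is an acyclic orientation of all edges of $G$. An immorality in a DAG is an induced subgraph $i\to j\leftarrow k$ (so $i,k$ are nonadjacent). Two DAGs are Markov equivalent iff they have the same skeleton and the same set of immoralities; a Markov equivalence class (MEC) with skeleton $G$ is an equivalence class of DAGs with skeleton $G$. $M(G)$ denotes the total number of MECs with skeleton $G$. $I_p$ is the path with $p$ vertices. $G_1(q)$ is the $q$-star: a center vertex joined to $q$ leaves ($q+1$ vertices; $G_1(0)$ is a single vertex). Fibonacci numbers: $F_0=F_1=1$, $F_p=F_{p-1}+F_{p-2}$ for $p\ge2$. *)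

(* Defs.v *)
From mathcomp Require Import all_boot.

Set Implicit Arguments.
Unset Strict Implicit.
Unset Printing Implicit Defensive.

Record sgraph := SGraph {
  vertex :> finType;
  edge : rel vertex;
  edge_sym : symmetric edge;
  edge_irrefl : irreflexive edge }.

Definition connected_graph (G : sgraph) := forall x y : G, connect (@edge G) x y.

(* A two-element sequence [:: x; y] is a ucycle of any symmetric relation with
   an edge between x and y; hence the bound on the size. *)
Definition cycle_free (G : sgraph) :=
  forall c : seq G, 2 < size c -> ~ ucycle (@edge G) c.

Definition tree (G : sgraph) := connected_graph G /\ cycle_free G.

Section Digraphs.
Variable V : finType.
Implicit Types D : {set V * V}.

Definition arrow D : rel V := [rel x y | (x, y) \in D].

Definition acyclic D := [forall x, forall y, arrow D x y ==> ~~ connect (arrow D) y x].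

Lemma acyclicP D :
  reflect (forall c : seq V, cycle (arrow D) c -> c = [::]) (acyclic D).
Proof.
apply: (iffP idP) => [/forallP acD [//|x c] /=|acD].
  case: c => [|y c] /=; first rewrite andbT => Dxx.
    by have /forallP/(_ x)/implyP/(_ Dxx) := acD x; rewrite connect0.
  case/andP=> Dxy yPx; have /forallP/(_ y)/implyP/(_ Dxy)/negP[] := acD x.
  by apply/connectP; exists (rcons c x); rewrite ?last_rcons.
apply/forallP => x; apply/forallP => y; apply/implyP => Dxy.
apply/negP => /connectP[c yc xE].
suff /acD : cycle (arrow D) (y :: c) by [].
by rewrite /= rcons_path yc -xE.
Qed.

Definition skeleton D : rel V := [rel x y | arrow D x y || arrow D y x].

(* An immorality i -> j <- k is recorded as both (i, j, k) and (k, j, i). *)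
Definition immoralities D : {set V * V * V} :=
  [set t | let: (i, j, k) := t in
           [&& arrow D i j, arrow D k j, i != k & ~~ skeleton D i k]].

Definition same_skeleton D1 D2 :=
  [forall x, forall y, skeleton D1 x y == skeleton D2 x y].

Definition markov_equiv : rel {set V * V} :=
  [rel D1 D2 | same_skeleton D1 D2 && (immoralities D1 == immoralities D2)].

End Digraphs.

Definition is_orientation (G : sgraph) (D : {set G * G}) :=
  [forall x, forall y, (edge x y == skeleton D x y) && ~~ (arrow D x y && arrow D y x)].

Definition dags (G : sgraph) : {set {set G * G}} :=
  [set D | is_orientation D && acyclic D].

Definition mecs (G : sgraph) : {set {set {set G * G}}} :=
  equivalence_partition (@markov_equiv G) (dags G).

Definition M (G : sgraph) : nat := #|mecs G|.

Definition path_rel p : rel 'I_p := [rel i j : 'I_p | (i.+1 == j :> nat) || (j.+1 == i :> nat)].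

Lemma path_rel_sym p : symmetric (@path_rel p).
Proof. by move=> i j; rewrite /path_rel /= orbC. Qed.

Lemma path_rel_irrefl p : irreflexive (@path_rel p).
Proof. by move=> i; rewrite /path_rel /= orbb gtn_eqF. Qed.

Definition path_graph p : sgraph := SGraph (@path_rel_sym p) (@path_rel_irrefl p).

(* The center is ord0. *)
Definition star_rel q : rel 'I_q.+1 :=
  [rel i j : 'I_q.+1 | (i != j) && ((i == ord0) || (j == ord0))].

Lemma star_rel_sym q : symmetric (@star_rel q).
Proof. by move=> i j; rewrite /star_rel /= eq_sym orbC. Qed.

Lemma star_rel_irrefl q : irreflexive (@star_rel q).
Proof. by move=> i; rewrite /star_rel /= eqxx. Qed.

Definition star_graph q : sgraph := SGraph (@star_rel_sym q) (@star_rel_irrefl q).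

(* Indexed so that fib 0 = fib 1 = 1. *)
Fixpoint fib n :=
  if n is n1.+1 then (if n1 is n2.+1 then fib n1 + fib n2 else 1) else 1.

(* Main.v *)
Require Import Defs.
From mathcomp Require Import all_boot zify.

(** All DAGs on a graph share its skeleton, so Markov equivalence compares
    immoralities only, and on a cycle-free graph every orientation is acyclic.
    Hence [M G] is the number of immorality sets, called patterns below, of
    orientations of [G] ([M_patterns]).  Patterns are counted for the subgraphs
    induced by vertex subsets [S] of a fixed graph, so that removing a leaf
    stays within one vertex type.

    Lower bound.  A tree on at least three vertices has a leaf [l], attached to
    some [v], and another neighbour [u] of [v], such that after removing [l]
    either [u] is a leaf attached to [v] or [v] is a leaf attached to [u]: take
    for [l] an end of a longest path ([exists_two_pendants]).  Let
    [S'] be the tree without [l], and [S''] the tree [S'] without that second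
    leaf.  Orienting the edge at [l] as [v -> l] extends each pattern of [S'] to
    one where [l -> v] is in no immorality; adding [l -> v <- u] extends each
    pattern of [S''] to one where it is.  Patterns of the induced subgraph can
    be read off by restriction, so no two coincide, and
    #|patterns S'| + #|patterns S''| <= #|patterns S| ([leq_patterns_pendant]).
    This is the Fibonacci recursion.

    Path.  When [v] has no neighbour but [l] and [u], every pattern of [S] arises
    in this way ([patterns_pendant_path]).  The second vertex of a path is of
    this kind, and the two smaller trees are again paths, so paths satisfy the
    recursion with equality.

    Upper bound.  A tree on [n] vertices has at most [2 ^ n.-1] orientations, and
    directing all edges away from a chosen root gives [n] of them that have no
    immorality.  These [n] share the empty pattern, so there are at most
    [2 ^ n.-1 - n + 1] patterns ([leq_patterns]).

    Star.  The set of leaves pointing to the centre can be recovered from the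
    pattern unless it is a singleton, which leaves [2 ^ q - q] distinct patterns
    ([leq_patterns_star]); the upper bound for trees says that there are no
    more. *)

Set Implicit Arguments.
Unset Strict Implicit.
Unset Printing Implicit Defensive.

(** * Patterns of induced subgraphs *)

Section Counting.
Variable G : sgraph.
Implicit Types (S A : {set G}) (D : {set G * G}) (I : {set G * G * G}).

(** Orientations of the subgraph induced by [S], with the vertices outside [S]
    kept as isolated ones, so that all [S] share one vertex type. *)
Definition orientations S : {set {set G * G}} :=
  [set D | [forall x, forall y,
     ([&& x \in S, y \in S & edge x y] == skeleton D x y)
       && ~~ (arrow D x y && arrow D y x)]].

Definition patterns S : {set {set G * G * G}} :=
  @immoralities G @: orientations S.

Lemma orientationsP S D :
  reflect ((forall x y, skeleton D x y = [&& x \in S, y \in S & edge x y]) /\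
           (forall x y, (x, y) \in D -> (y, x) \notin D))
          (D \in orientations S).
Proof.
rewrite inE; apply: (iffP idP) => [/forallP oD | [skD asD]].
  split=> x y; have /forallP/(_ y)/andP[/eqP skD asD] := oD x; first by rewrite skD.
  by move=> Dxy; apply: contra asD => Dyx; apply/andP.
apply/forallP=> x; apply/forallP=> y; rewrite skD eqxx /=.
by apply/andP=> -[/asD/negP].
Qed.

Lemma orientations_arrow S D x y :
  D \in orientations S -> (x, y) \in D -> [/\ x \in S, y \in S & edge x y].
Proof.
case/orientationsP=> skD _ Dxy; apply/and3P.
by rewrite -skD /skeleton /= /arrow /= Dxy.
Qed.

Lemma orientations_setT :
  orientations [set: G] = [set D | is_orientation D].
Proof.
apply/setP=> D; rewrite !inE; apply: eq_forallb => x; apply: eq_forallb => y.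
by rewrite !in_setT.
Qed.

Lemma immoralitiesE D i j k :
  ((i, j, k) \in immoralities D) =
  [&& (i, j) \in D, (k, j) \in D, i != k & ~~ skeleton D i k].
Proof. by rewrite inE. Qed.

Lemma immoralities_sym D i j k :
  ((i, j, k) \in immoralities D) = ((k, j, i) \in immoralities D).
Proof.
rewrite !immoralitiesE eq_sym [skeleton D i k]orbC.
by case: ((i, j) \in D); case: ((k, j) \in D).
Qed.

(** A directed cycle yields a simple one; it has more than two vertices because
    no edge is directed both ways. *)
Lemma cycle_free_acyclic D :
  cycle_free G -> is_orientation D -> acyclic D.
Proof.
move=> cfG /forallP oD; apply/forallP=> x; apply/forallP=> y; apply/implyP=> Dxy.
apply/negP=> /connectP[c0 yc0 xE].
case/shortenP: yc0 xE => c yc Uc _ xE {c0}.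
have sub : subrel (arrow D) (@edge G).
  move=> a b Dab; have /forallP/(_ b)/andP[/eqP-> _] := oD a.
  by rewrite /skeleton /= Dab.
case: (ltnP 2 (size (y :: c))) => [/cfG[] | ].
  rewrite /ucycle Uc andbT /= rcons_path -xE (sub_path sub yc) /=.
  exact: sub.
have nxyx : ~~ (arrow D x y && arrow D y x).
  by have /forallP/(_ y)/andP[] := oD x.
case: c yc xE {Uc} => [_ /= xy | z [|//] /= /andP[Dyz _] xz] _.
  by case/negP: nxyx; rewrite -xy in Dxy; rewrite -xy Dxy.
by move: nxyx; rewrite Dxy xz Dyz.
Qed.

(** The classes of an equivalence defined by equality of immoralities are the
    nonempty fibres of [immoralities]. *)
Lemma M_patterns : cycle_free G -> M G = #|patterns [set: G]|.
Proof.
move=> cfG.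
have dE : dags G = orientations [set: G].
  rewrite orientations_setT; apply/setP=> D; rewrite in_set [RHS]in_set.
  by apply: andb_idr; apply: cycle_free_acyclic.
pose fiber I := [set D in orientations [set: G] | I == immoralities D].
rewrite /M /mecs /patterns.
have -> : equivalence_partition (@markov_equiv G) (dags G) =
          fiber @: (@immoralities G @: orientations [set: G]).
  rewrite dE /equivalence_partition -imset_comp; apply: eq_in_imset => D1 oD1 /=.
  apply/setP=> D2; rewrite !inE; case oD2: [forall x, _] => //=.
  rewrite /markov_equiv /=; case: eqP; rewrite ?andbF ?andbT // => _.
  have oD2' : D2 \in orientations [set: G] by rewrite inE.
  apply/forallP=> x; apply/forallP=> y.
  case/orientationsP: oD1 => -> _; case/orientationsP: oD2' => -> _.
  by rewrite eqxx.
apply: card_in_imset => I1 I2 /imsetP[D oD ->] _ /setP/(_ D).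
by rewrite !inE eqxx; rewrite inE in oD; rewrite oD /= => /esym/eqP.
Qed.

Definition triples S := setX (setX S S) S.

Lemma orientations_restrict S S' D :
  S' \subset S -> D \in orientations S -> D :&: setX S' S' \in orientations S'.
Proof.
move=> sS /orientationsP[skD asD]; apply/orientationsP; split=> x y.
  rewrite /skeleton /= /arrow /= !inE /=.
  case xS: (x \in S'); case yS: (y \in S'); rewrite ?andbF //=.
  have := skD x y; rewrite (subsetP sS x xS) (subsetP sS y yS) /= => <-.
  by rewrite !andbT.
by rewrite !inE /= => /andP[/asD/negPf-> _].
Qed.

(** Both parts of being an immorality, arrows and non-adjacency, concern only the
    three vertices involved; this is why restricting to induced subgraphs, as
    opposed to deleting edges, commutes with taking immoralities. *)
Lemma immoralities_restrict S D :
  immoralities (D :&: setX S S) = immoralities D :&: triples S.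
Proof.
apply/setP=> -[[i j] k]; rewrite [RHS]in_setI !immoralitiesE !in_setX /=.
rewrite /skeleton /= /arrow /= !inE /=.
by case: (i \in S); case: (j \in S); case: (k \in S); rewrite ?andbF ?andbT.
Qed.

(** * Attaching a leaf *)

Definition pendant S l v :=
  [/\ l \in S, v \in S, edge l v & forall w, w \in S -> edge l w -> w = v].

Lemma pendant_neq S l v : pendant S l v -> v != l.
Proof.
by case=> _ _ elv _; apply/eqP=> vl; move: elv; rewrite vl edge_irrefl.
Qed.

Lemma pendant_edge S l v x y : pendant S l v -> x \in S -> y \in S ->
  edge x y = [|| [&& x \in S :\ l, y \in S :\ l & edge x y],
              (x, y) == (l, v) | (x, y) == (v, l)].
Proof.
move=> [lS vS elv lv] xS yS; rewrite !inE xS yS !andbT !xpair_eqE.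
have evl : edge v l by rewrite edge_sym.
have vl := pendant_neq (And4 lS vS elv lv).
case: (eqVneq x l) => [->|xl] /=.
  rewrite [l == v]eq_sym (negPf vl) /= orbF; apply/idP/eqP => [|->//]; exact: lv.
case: (eqVneq y l) => [->|yl] /=; last by rewrite !andbF !orbF.
rewrite andbT; apply/idP/eqP => [|->//]; rewrite edge_sym; exact: lv.
Qed.

Lemma skeleton_setU1 D a b x y :
  skeleton ((a, b) |: D) x y =
  [|| skeleton D x y, (x, y) == (a, b) | (x, y) == (b, a)].
Proof.
rewrite /skeleton /= /arrow /= !inE !xpair_eqE [(y == a) && _]andbC.
by do 2![case: (_ && _); rewrite ?orbT ?orbF //=].
Qed.

(** Either direction of the edge at a leaf extends an orientation of the rest,
    and restriction undoes the extension. *)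
Lemma orientations_pendant S l v a b D :
  pendant S l v -> (a, b) \in [:: (l, v); (v, l)] ->
  D \in orientations (S :\ l) ->
  (a, b) |: D \in orientations S /\ ((a, b) |: D) :&: setX (S :\ l) (S :\ l) = D.
Proof.
move=> pS ab oD; have [skD asD] := orientationsP _ _ oD.
have [lS vS elv lv] := pS; have vl := pendant_neq pS.
have abl : (a == l) || (b == l).
  move: ab; rewrite !inE !xpair_eqE => /orP[]/andP[/eqP-> /eqP->];
    by rewrite eqxx ?orbT.
have Dnl x y : (x, y) \in D -> (x != l) && (y != l).
  by case/(orientations_arrow oD); rewrite !inE => /andP[-> _] /andP[-> _].
split; last first.
  apply/setP=> -[x y]; rewrite !inE /= xpair_eqE.
  apply/andP/idP=> [[/orP[/andP[/eqP-> /eqP->]|//]]|Dxy].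
    by case/orP: abl => /eqP->; rewrite eqxx ?andbF.
  by have [] := orientations_arrow oD Dxy; rewrite !inE Dxy orbT => -> ->.
apply/orientationsP; split=> x y.
  rewrite skeleton_setU1 skD; case xyS: ((x \in S) && (y \in S)).
    have /andP[xS yS] := xyS; rewrite xS yS /= [in RHS](pendant_edge pS xS yS).
    congr (_ || _).
    by move: ab; rewrite !inE => /orP[]/eqP[-> ->] //; rewrite orbC.
  rewrite !inE [RHS]andbA xyS /=; apply/negbTE; apply/negP.
  case/orP=> [/and3P[/andP[_ xS] /andP[_ yS] _]|]; first by rewrite xS yS in xyS.
  have [aS bS] : a \in S /\ b \in S by move: ab; rewrite !inE => /orP[]/eqP[-> ->].
  by case/orP=> /eqP[xE yE]; rewrite xE yE aS bS in xyS.
have ba : a != b by move: ab; rewrite !inE => /orP[]/eqP[-> ->] //; rewrite eq_sym.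
rewrite !inE => /orP[/eqP[-> ->]|Dxy].
  rewrite xpair_eqE eq_sym (negPf ba) /=; apply/negP=> /Dnl.
  by case/orP: abl => /eqP->; rewrite eqxx ?andbF.
rewrite (negPf (asD _ _ Dxy)) orbF xpair_eqE; apply/negP=> /andP[/eqP yE /eqP xE].
by have := Dnl _ _ Dxy; rewrite yE xE; case/orP: abl => /eqP->; rewrite eqxx ?andbF.
Qed.

Lemma patterns_restrict S S' I :
  S' \subset S -> I \in patterns S -> I :&: triples S' \in patterns S'.
Proof.
move=> sS /imsetP[D oD ->]; rewrite -immoralities_restrict imset_f //.
exact: orientations_restrict oD.
Qed.

Definition colliding_arrow (l v : G) : {set {set G * G * G}} :=
  [set I : {set G * G * G} | [exists k, (l, v, k) \in I]].

(** The two families of patterns are told apart by whether the arrow [l -> v]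
    takes part in an immorality.  The edge [(x, y)] is the edge [vu] with its
    leaf end in [S :\ l] first, so [S :\ l :\ x] loses [v] in one case and [u] in
    the other; in both, adding [u -> v] and then [l -> v] creates the immorality
    [l -> v <- u]. *)
Lemma leq_patterns_pendant S l v u x y :
  pendant S l v -> pendant (S :\ l) x y -> (x, y) \in [:: (v, u); (u, v)] ->
  #|patterns (S :\ l)| + #|patterns (S :\ l :\ x)| <= #|patterns S|.
Proof.
move=> pS pS' xy; rewrite -(cardsID (colliding_arrow l v) (patterns S)) addnC.
have [_ _ _ lv] := pS.
apply: leq_add.
  (* Patterns with a collision at l -> v restrict onto those of S :\ l :\ x. *)
  apply: leq_trans (leq_imset_card (fun I => I :&: triples (S :\ l :\ x)) _).
  apply: subset_leq_card; apply/subsetP=> _ /imsetP[D oD ->].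
  have uv : (u, v) \in [:: (x, y); (y, x)].
    by move: xy; rewrite !inE => /orP[]/eqP[-> ->]; rewrite eqxx ?orbT.
  have [oD' resD'] := orientations_pendant pS' uv oD.
  have [oD2 resD2] := orientations_pendant pS (mem_head _ _) oD'.
  apply/imsetP; exists (immoralities ((l, v) |: ((u, v) |: D))); last first.
    rewrite -immoralities_restrict; congr immoralities.
    suff -> : setX (S :\ l :\ x) (S :\ l :\ x) =
              setX (S :\ l) (S :\ l) :&: setX (S :\ l :\ x) (S :\ l :\ x).
      by rewrite setIA resD2 resD'.
    by apply/esym/setIidPr/setXS; apply: subsetDl.
  have [uS vS' euv] := orientations_arrow oD' (setU11 _ _).
  rewrite inE imset_f //= inE; apply/existsP; exists u.
  have [ul uS'] := setD1P uS; have [skD2 _] := orientationsP _ _ oD2.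
  rewrite immoralitiesE setU11 setU1r ?setU11 //= eq_sym ul skD2 /=.
  apply/and3P=> -[_ _ /(lv u uS') uE].
  by rewrite uE edge_irrefl in euv.
(* Patterns without such a collision restrict onto those of S :\ l. *)
apply: leq_trans (leq_imset_card (fun I => I :&: triples (S :\ l)) _).
apply: subset_leq_card; apply/subsetP=> _ /imsetP[D oD ->].
have vlP : (v, l) \in [:: (l, v); (v, l)] by rewrite !inE eqxx orbT.
have [oD' resD'] := orientations_pendant pS vlP oD.
apply/imsetP; exists (immoralities ((v, l) |: D)); last first.
  by rewrite -immoralities_restrict resD'.
rewrite inE imset_f // andbT inE; apply/existsP=> -[k].
rewrite immoralitiesE => /andP[lvD _].
by have [_ /(_ v l (setU11 _ _))/negP] := orientationsP _ _ oD'; apply.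
Qed.

Lemma immorality_edges S D i j k : D \in orientations S ->
  (i, j, k) \in immoralities D ->
  [/\ i \in S, j \in S & k \in S] /\ [/\ edge j i, edge j k & i != k].
Proof.
move=> oD; rewrite immoralitiesE => /and4P[/(orientations_arrow oD)[iS jS eij]].
by case/(orientations_arrow oD)=> kS _ ekj ik _; rewrite !(edge_sym j).
Qed.

(** When [v] has only the neighbours [l] and [u], the restrictions above are also
    injective.  A pattern in which [l -> v] does not collide has no immorality
    through [l]; one in which it does contains [l -> v <- u] and, as [v] then has
    no outgoing arrow, no other immorality through [l] or [v]. *)
Lemma patterns_pendant_path S l v u :
  pendant S l v -> pendant (S :\ l) v u ->
  #|patterns S| = #|patterns (S :\ l)| + #|patterns (S :\ l :\ v)|.
Proof.
move=> pS pS'; apply/eqP; rewrite eqn_leq (leq_patterns_pendant pS pS' (mem_head _ _)).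
rewrite andbT -(cardsID (colliding_arrow l v) (patterns S)) addnC.
have [lS vS elv lv] := pS; have vl := pendant_neq pS.
have [vS' uS' evu vu] := pS'.
have sS' : S :\ l \subset S by apply: subsetDl.
have nbl D a b c : D \in orientations S -> (a, b, c) \in immoralities D -> b != l.
  move=> oD /(immorality_edges oD)[[aS bS cS] [eba ebc /eqP nac]].
  apply/eqP=> bl; rewrite bl in eba ebc.
  by apply: nac; rewrite (lv a) // (lv c).
apply: leq_add.
  rewrite -(@card_in_imset _ _ (fun I => I :&: triples (S :\ l))).
    apply: subset_leq_card; apply/subsetP=> _ /imsetP[I IP ->].
    by apply: (patterns_restrict sS'); case/setDP: IP.
  (* Such a pattern equals its restriction, so restricting is injective. *)
  suff triE I : I \in patterns S :\: colliding_arrow l v -> I = I :&: triples (S :\ l).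
    by move=> I1 I2 /triE E1 /triE E2 E; rewrite E1 E2 E.
  case/setDP=> /imsetP[D oD ->]; rewrite inE => /existsP nI; symmetry; apply/setIidPl.
  apply/subsetP=> -[[i j] k] Iijk.
  have [[iS jS kS] [eji ejk _]] := immorality_edges oD Iijk.
  have nl a b c : (a, b, c) \in immoralities D -> a != l.
    move=> Iabc; apply/eqP=> al; apply: nI; exists c.
    have [[_ bS _] [eba _ _]] := immorality_edges oD Iabc.
    by rewrite -(lv b bS) -al // edge_sym.
  rewrite !inE iS jS kS (nl _ _ _ Iijk) (nbl _ _ _ _ oD Iijk) /= andbT.
  by rewrite immoralities_sym in Iijk; apply: nl Iijk.
rewrite -(@card_in_imset _ _ (fun I => I :&: triples (S :\ l :\ v))).
  apply: subset_leq_card; apply/subsetP=> _ /imsetP[I IP ->].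
  apply: (patterns_restrict (subset_trans (subsetDl _ _) sS')).
  by case/setIP: IP.
(* The part lost by restricting is the same for all these patterns. *)
suff triE I : I \in patterns S :&: colliding_arrow l v ->
    I = [set (l, v, u); (u, v, l)] :|: I :&: triples (S :\ l :\ v).
  by move=> I1 I2 /triE E1 /triE E2 E; rewrite E1 E2 E.
case/setIP=> /imsetP[D oD ->]; rewrite inE => /existsP[k0 Ik0].
have nbr a : a \in S -> edge v a -> a = l \/ a = u.
  move=> aS eva; case: (eqVneq a l) => [|al]; [by left|right].
  by apply: vu eva; rewrite !inE al.
have [[_ _ k0S] [_ evk lk]] := immorality_edges oD Ik0.
have k0u : k0 = u by case: (nbr k0 k0S evk) => // k0l; rewrite k0l eqxx in lk.
rewrite {k0 k0S evk lk}k0u in Ik0.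
have Iu : (u, v, l) \in immoralities D by rewrite immoralities_sym.
have nv a b c : (a, b, c) \in immoralities D -> a != v.
  move=> Iabc; apply/eqP=> av; rewrite {a}av in Iabc.
  have [[_ bS _] [eb _ _]] := immorality_edges oD Iabc.
  have [_ asD] := orientationsP _ _ oD.
  have : (v, b) \in D by move: Iabc; rewrite immoralitiesE => /and4P[].
  move/asD/negP; apply; move: Ik0; rewrite immoralitiesE => /and4P[Dlv Duv _ _].
  by rewrite edge_sym in eb; case: (nbr b bS eb) => ->.
apply/setP=> -[[i j] k]; rewrite in_setU in_setI in_set2.
apply/idP/orP=> [Iijk|[/orP[]/eqP-> //|/andP[]//]].
have [[iS jS kS] [eji ejk ik]] := immorality_edges oD Iijk.
have jl := nbl _ _ _ _ oD Iijk.
case: (eqVneq j v) => [jv|jv].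
  left; rewrite {j jS jl Iijk}jv in eji ejk *.
  by case: (nbr i iS eji) (nbr k kS ejk) ik => -> [] ->; rewrite ?eqxx ?orbT.
have Ikji : (k, j, i) \in immoralities D by rewrite immoralities_sym.
have nl a : a \in S -> edge j a -> a != l.
  move=> aS eja; apply: contra_neqN jv => /eqP al.
  by apply: lv => //; rewrite -al edge_sym.
right; rewrite Iijk !inE iS jS kS jv jl (nl i) // (nl k) //.
by rewrite (nv _ _ _ Iijk) (nv _ _ _ Ikji).
Qed.

(** * Leaves of a tree *)

(** Connectedness of the induced subgraph, expressed by cuts: this form
    survives the removal of a leaf without any surgery on paths. *)
Definition joined S := forall A, A \proper S -> A != set0 ->
  exists a b, [/\ a \in A, b \in S :\: A & edge a b].

(** To cross a cut of [S :\ l], put [l] on the side of its neighbour [v]; the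
    edge of [S] crossing the resulting cut cannot be [lv]. *)
Lemma joined_pendant S l v : pendant S l v -> joined S -> joined (S :\ l).
Proof.
move=> pS jS A pA A0; have [lS vS elv lv] := pS.
have sA : A \subset S :\ l := proper_sub pA.
have lA : l \notin A by apply/negP=> /(subsetP sA); rewrite !inE eqxx.
have sAS : A \subset S := subset_trans sA (subsetDl _ _).
have [_ [z zS zA]] := properP pA; have [zl zS'] := setD1P zS.
case vA: (v \in A).
  have [||a [b [aA bS eab]]] := jS (l |: A).
  - apply/properP; split; first by rewrite subUset sub1set lS.
    by exists z; rewrite // !inE negb_or zl.
  - by apply/set0Pn; exists l; rewrite setU11.
  exists a, b; move: bS; rewrite !inE negb_or => /andP[/andP[bl bA] bS].
  split=> //; last by rewrite bA bl.
  case/setU1P: aA => // al; rewrite al in eab.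
  by rewrite (lv b bS eab) vA in bA.
have [|//|a [b [aA bS eab]]] := jS A.
  by apply/properP; split=> //; exists z.
exists a, b; move: bS; rewrite !inE => /andP[bA bS]; rewrite bA bS andbT; split=> //=.
apply: contraFN vA => /eqP bl; rewrite -(lv a (subsetP sAS a aA)) //.
by rewrite edge_sym -bl.
Qed.

Lemma joined_setT : connected_graph G -> joined [set: G].
Proof.
move=> cG A /properP[_ [y _ yA]] /set0Pn[x xA].
case: (pickP [pred t : G * G | [&& t.1 \in A, t.2 \notin A & edge t.1 t.2]]).
  by move=> [a b] /= /and3P[aA bA eab]; exists a, b; rewrite !inE bA.
move=> nAB; suff clA : closed (@edge G) A.
  by rewrite -(closed_connect clA (cG x y)) xA in yA.
apply: intro_closed; first exact: sym_connect_sym (@edge_sym G).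
move=> a b eab aA; apply: contraFT (nAB (a, b)) => bA /=.
by rewrite aA bA eab.
Qed.

Definition simple_path S (s : seq G) := [&& sorted (@edge G) s, uniq s & all (mem S) s].

Lemma path_no_chord x y s z : cycle_free G ->
  path (@edge G) x (y :: s) -> uniq (x :: y :: s) -> z \in s -> ~~ edge z x.
Proof.
move=> cG pxs Us zs; apply/negP=> ezx.
case/splitPr: zs pxs Us => s1 s2.
rewrite -cat_rcons -!cat_cons cat_path cat_uniq => /andP[pxs _] /and3P[Us _ _].
apply: (cG (x :: y :: rcons s1 z)); first by rewrite /= size_rcons.
by rewrite /ucycle Us andbT /cycle rcons_path pxs last_cons last_rcons.
Qed.

Lemma exists_longest_path S s0 : simple_path S s0 ->
  exists s, [/\ simple_path S s, size s0 <= size s &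
                forall s', simple_path S s' -> size s' <= size s].
Proof.
move=> Ss0; pose len n := [exists t : n.-tuple G, simple_path S t].
have lenP s : simple_path S s -> len (size s).
  by move=> Ss; apply/existsP; exists (in_tuple s).
have bound n : len n -> n <= #|G|.
  case/existsP=> t /and3P[_ Ut _].
  by rewrite -(size_tuple t) -(card_uniqP Ut) max_card.
case: (ex_maxnP (ex_intro len _ (lenP _ Ss0)) bound) => n /existsP[t St] max.
exists t; split=> // [|s' /lenP/max]; last by rewrite size_tuple.
by rewrite size_tuple; apply: max; apply: lenP.
Qed.

(** A further neighbour of the first vertex would prolong the path if it is off
    the path, and close a cycle if it is on it. *)
Lemma longest_path_pendant S x0 x1 s : cycle_free G ->
  simple_path S [:: x0, x1 & s] ->
  (forall s', simple_path S s' -> size s' <= size [:: x0, x1 & s]) ->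
  pendant S x0 x1.
Proof.
move=> cG /and3P[ps Us Ss] max.
have [e01 x0S x1S] : [/\ edge x0 x1, x0 \in S & x1 \in S].
  by split; [case/andP: ps | case/andP: Ss | case/and3P: Ss].
split=> // w wS e0w; case: (boolP (w \in [:: x0, x1 & s])) => [|wns].
  rewrite !inE => /or3P[/eqP wx | /eqP-> // | ws].
    by rewrite wx edge_irrefl in e0w.
  by case/negP: (path_no_chord cG ps Us ws); rewrite edge_sym.
have : simple_path S [:: w, x0, x1 & s].
  apply/and3P; split; last by apply/andP.
    by apply/andP; split=> //; rewrite edge_sym.
  by apply/andP.
by move/max; rewrite /= ltnn.
Qed.

Lemma joined_edge S : joined S -> 1 < #|S| ->
  exists a b, [/\ a \in S, b \in S & edge a b].
Proof.
move=> jS S1; have /card_gt0P[x xS] := ltnW S1.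
have [||a [b [/set1P-> /setDP[bS _] exb]]] := jS [set x]; last by exists x, b.
  by rewrite properEcard sub1set xS cards1.
by apply/set0Pn; exists x; rewrite set11.
Qed.

Lemma edge_simple_path S a b : a \in S -> b \in S -> edge a b ->
  simple_path S [:: a; b].
Proof.
move=> aS bS eab; rewrite /simple_path /= eab aS bS inE !andbT /=.
by apply: contraTneq eab => ->; rewrite edge_irrefl.
Qed.

Lemma exists_pendant S : cycle_free G -> joined S -> 1 < #|S| ->
  exists l v, pendant S l v.
Proof.
move=> cG jS S1; have [a [b [aS bS eab]]] := joined_edge jS S1.
have [[|x0 [|x1 s]] [Ss lts max] //] := exists_longest_path (edge_simple_path aS bS eab).
by exists x0, x1; apply: longest_path_pendant Ss max.
Qed.

Lemma exists_simple_path3 S : joined S -> 2 < #|S| ->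
  exists a b c, simple_path S [:: a; b; c].
Proof.
move=> jS S2; have [a [b [aS bS eab]]] := joined_edge jS (ltnW S2).
have [||c [d [cab /setDP[dS dab] ecd]]] := jS [set a; b].
- rewrite properEcard subUset !sub1set aS bS /=.
  by apply: leq_ltn_trans S2; rewrite cards2; case: (_ != _).
- by apply/set0Pn; exists a; rewrite set21.
wlog cb : a b aS bS eab cab dab / c = b.
  move=> th; case/set2P: (cab) => cE; last exact: (th a b).
  by apply: (th b a) => //; rewrite 1?edge_sym // setUC.
exists a, b, d; rewrite cb in ecd; move: dab; rewrite !inE negb_or => /andP[da db].
rewrite /simple_path /= eab ecd aS bS dS !inE negb_or ![_ == d]eq_sym da db !andbT /=.
by apply: contraTneq eab => ->; rewrite edge_irrefl.
Qed.

(** Let [l, v, u] begin a longest path.  If [v] has a neighbour [y] besides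
    [l] and [u], replacing [l] by [y] gives another longest path, so [y] is a leaf
    attached to [v]; otherwise [v] becomes a leaf once [l] is removed. *)
Lemma exists_two_pendants S : cycle_free G -> joined S -> 2 < #|S| ->
  exists l v u x y, [/\ pendant S l v, pendant (S :\ l) x y &
                        (x, y) \in [:: (v, u); (u, v)]].
Proof.
move=> cG jS S2; have [a [b [c Sabc]]] := exists_simple_path3 jS S2.
have [[|l [|v [|u s]]] [Ss lts max] //] := exists_longest_path Sabc.
have pS := longest_path_pendant cG Ss max.
have [lS vS elv lv] := pS; have vl := pendant_neq pS.
have /and3P[ps Us inS] := Ss.
case: (pickP [pred y in S | [&& edge v y, y != l & y != u]]) => [y|noy].
  case/and4P=> yS evy yl yu.
  have Sys : simple_path S [:: y, v, u & s].
    have yn : y \notin [:: v, u & s].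
      rewrite !inE !negb_or yu (contraTneq _ evy) => [|->]; last by rewrite edge_irrefl.
      apply: contraTN evy => ys; rewrite edge_sym.
      by apply: (@path_no_chord v u s y cG) => //; [case/andP: ps | case/andP: Us].
    apply/and3P; split; last by apply/andP; split=> //; case/andP: inS.
      by case/andP: ps => _ pvs; apply/andP; rewrite edge_sym.
    by case/andP: Us => _ Uvs; apply/andP.
  have [_ _ eyv yv] := longest_path_pendant cG Sys max.
  exists l, v, y, y, v; rewrite !inE eqxx orbT; split=> //.
  by split; rewrite ?inE ?yl ?vl // => w /setD1P[_ wS]; apply: yv.
exists l, v, u, v, u; rewrite mem_head; split=> //.
have [uS evu ul] : [/\ u \in S, edge v u & u != l].
  case/and3P: ps => _ evu _; case/and4P: inS => _ _ uS _; split=> //.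
  by move: Us; rewrite [u == l]eq_sym /= !inE !negb_or => /andP[/and3P[]].
split; rewrite ?inE ?vl ?ul // => w /setD1P[wl wS] evw.
by apply/eqP; apply: contraFT (noy w) => wu; rewrite /= wS evw wl.
Qed.

Lemma joined_ind (P : {set G} -> Prop) : cycle_free G ->
  (forall x, P [set x]) ->
  (forall S l v, pendant S l v -> P (S :\ l) -> P S) ->
  forall S, joined S -> 0 < #|S| -> P S.
Proof.
move=> cG P1 PS S; have [n] := ubnP #|S|; elim: n S => // n IHn S leSn jS S0.
have [|S1] := leqP #|S| 1.
  by rewrite leq_eqVlt ltnNge S0 orbF => /cards1P[x ->].
have [l [v pS]] := exists_pendant cG jS S1; apply: (PS S l v pS).
have [lS _ _ _] := pS; rewrite (cardsD1 l) lS in leSn S1.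
by apply: IHn (joined_pendant pS jS) _.
Qed.

(** * Bounds for trees *)

(** For an orientation of a tree on [S], this says that all edges point away
    from [r]. *)
Definition rooted_at r S D :=
  [/\ forall x y z, (x, z) \in D -> (y, z) \in D -> x = y &
      forall z, [exists y, (y, z) \in D] = (z \in S :\ r)].

(** Induction on the number of vertices: if the root is the leaf [l], root the
    rest at the neighbour of [l]. *)
Lemma exists_rooted_orientation S : cycle_free G -> joined S -> 0 < #|S| ->
  forall r, r \in S -> exists2 D, D \in orientations S & rooted_at r S D.
Proof.
move=> cG jS S0; pattern S.
apply: joined_ind S jS S0 => // [x _ /set1P-> | S l v pS IHS r rS].
  exists set0; last first.
    split=> [a b c|z]; rewrite ?inE // andNb.
    by apply/existsP=> -[y]; rewrite inE.
  apply/orientationsP; split=> [a b|a b]; last by rewrite inE.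
  rewrite /skeleton /= /arrow /= !inE; apply/esym/and3P=> -[/eqP-> /eqP->].
  by rewrite edge_irrefl.
have [lS vS elv lv] := pS; have vl := pendant_neq pS.
case: (eqVneq r l) => [->|rl].
  have [|D oD [uD rD]] := IHS v; first by rewrite !inE vl.
  have noDv y : (y, v) \notin D.
    by have := rD v; rewrite !inE eqxx => /existsPn; apply.
  have [oD' _] := orientations_pendant pS (mem_head _ _) oD.
  exists ((l, v) |: D) => //; split=> [x y z|z].
    rewrite !inE !xpair_eqE; case: (eqVneq z v) => [->|zv]; last first.
      by rewrite !andbF; apply: uD.
    by rewrite !andbT !(negPf (noDv _)) !orbF => /eqP-> /eqP->.
  case: (eqVneq z v) => [->|zv].
    by rewrite !inE vl vS; apply/existsP; exists l; rewrite setU11.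
  rewrite !inE -[RHS]/((z != l) && (z \in S)).
  have := rD z; rewrite !inE zv /= => <-; apply: eq_existsb => y.
  by rewrite !inE xpair_eqE (negPf zv) andbF.
have [|D oD [uD rD]] := IHS r; first by rewrite !inE rl.
have vlP : (v, l) \in [:: (l, v); (v, l)] by rewrite !inE eqxx orbT.
have [oD' _] := orientations_pendant pS vlP oD.
have noDl y : (y, l) \notin D.
  by apply/negP=> /(orientations_arrow oD)[_]; rewrite !inE eqxx.
exists ((v, l) |: D) => //; split=> [x y z|z].
  rewrite !inE !xpair_eqE; case: (eqVneq z l) => [->|zl]; last first.
    by rewrite !andbF; apply: uD.
  by rewrite !andbT !(negPf (noDl _)) !orbF => /eqP-> /eqP->.
case: (eqVneq z l) => [->|zl].
  by rewrite !inE eq_sym rl lS; apply/existsP; exists v; rewrite setU11.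
have := rD z; rewrite !inE zl /= => <-; apply: eq_existsb => y.
by rewrite !inE xpair_eqE (negPf zl) andbF.
Qed.

Lemma rooted_no_immorality r S D : rooted_at r S D -> immoralities D = set0.
Proof.
case=> uD _; apply/setP=> -[[i j] k]; rewrite immoralitiesE in_set0.
by apply/and4P=> -[Dij Dkj /eqP[]]; rewrite (uD i k j).
Qed.

(** Orienting the edges along an enumeration of the vertices gives a pattern on
    any graph. *)
Lemma patterns_gt0 S : 0 < #|patterns S|.
Proof.
pose D := [set t : G * G | [&& t.1 \in S, t.2 \in S & edge t.1 t.2]
                          && (enum_rank t.1 < enum_rank t.2)].
apply/card_gt0P; exists (immoralities D); apply/imset_f/orientationsP.
split=> x y; rewrite /skeleton /= /arrow /= !inE /=; last first.
  by case/andP=> _ /ltnW; rewrite leqNgt andbC => /negPf->.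
rewrite [edge y x]edge_sym; case exy: (edge x y); rewrite ?andbF //= !andbT.
have neq : enum_rank x != enum_rank y :> nat.
  by apply: contraTneq exy => /ord_inj/enum_rank_inj->; rewrite edge_irrefl.
by rewrite [(y \in S) && _]andbC -andb_orr -neq_ltn neq andbT.
Qed.

Lemma patterns_eq1 S :
  (forall x y z, x \in S -> y \in S -> z \in S -> edge y x -> edge y z -> x = z) ->
  #|patterns S| = 1.
Proof.
move=> noS; apply/eqP; rewrite eqn_leq patterns_gt0 andbT.
apply: leq_trans (_ : #|[set (set0 : {set G * G * G})]| <= _); last by rewrite cards1.
apply: subset_leq_card; apply/subsetP=> _ /imsetP[D oD ->]; rewrite inE.
apply/eqP/setP=> -[[i j] k]; rewrite in_set0; apply/negP.
case/(immorality_edges oD)=> -[iS jS kS] [eji ejk /eqP[]].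
exact: (noS i j k).
Qed.

Lemma fib_leq_patterns S n : cycle_free G -> joined S -> #|S| = n.+1 ->
  fib n <= #|patterns S|.
Proof.
move=> cG; have [m] := ubnP n; elim: m n S => // m IHm n S ltnm jS Sn.
case: n => [|[|n]] in ltnm Sn *; try exact: patterns_gt0.
have [|l [v [u [x [y [pS pS' xy]]]]]] := exists_two_pendants cG jS; first by rewrite Sn.
apply: leq_trans (leq_patterns_pendant pS pS' xy).
have jS' := joined_pendant pS jS.
have [lS _ _ _] := pS; have [xS _ _ _] := pS'.
move: Sn; rewrite (cardsD1 l) lS => -[Sn]; have := Sn; rewrite (cardsD1 x) xS => -[Sn'].
rewrite /= -/(fib n.+1); apply: leq_add; apply: IHm => //.
  exact: ltnW.
exact: joined_pendant pS' jS'.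
Qed.

(** An orientation is determined by its restriction to the complement of a leaf
    and the direction of the edge at that leaf. *)
Lemma leq_orientations S : cycle_free G -> joined S -> 0 < #|S| ->
  #|orientations S| <= 2 ^ #|S|.-1.
Proof.
move=> cG jS S0; pattern S.
apply: joined_ind S jS S0 => // [x | S l v pS IHS].
  apply: leq_trans (_ : #|[set (set0 : {set G * G})]| <= _); last by rewrite !cards1.
  apply: subset_leq_card.
  apply/subsetP=> D oD; rewrite inE; apply/eqP/setP=> -[a b]; rewrite in_set0.
  apply/negP=> /(orientations_arrow oD)[/set1P-> /set1P->].
  by rewrite edge_irrefl.
have [lS vS elv lv] := pS; have vl := pendant_neq pS.
have S'0 : 0 < #|S :\ l| by apply/card_gt0P; exists v; rewrite !inE vl.
rewrite (cardsD1 l) lS add1n /= -(prednK S'0) expnS mulnC.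
apply: leq_trans (leq_mul IHS (leqnn 2)).
rewrite -card_bool -cardsT -cardsX.
pose f D := (D :&: setX (S :\ l) (S :\ l), (l, v) \in D).
rewrite -(@card_in_imset _ _ f) => [|D1 D2 oD1 oD2 [eD elD]].
  apply: subset_leq_card; apply/subsetP=> _ /imsetP[D oD ->].
  by rewrite in_setX in_setT andbT; apply: orientations_restrict oD; apply: subsetDl.
have evlD D : D \in orientations S -> ((v, l) \in D) = ((l, v) \notin D).
  case/orientationsP=> skD asD; apply/idP/idP=> [|]; first exact: asD.
  have := skD l v; rewrite lS vS elv /skeleton /= /arrow /= => /orP[-> //|//].
apply/setP=> -[a b]; case abS: ((a \in S) && (b \in S)); last first.
  by apply/idP/idP=> Dab;
    [have := orientations_arrow oD1 Dab | have := orientations_arrow oD2 Dab];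
    case=> aS bS; rewrite aS bS in abS.
have /andP[aS bS] := abS.
case: (boolP ((a, b) \in setX (S :\ l) (S :\ l))) => [abS'|abnS'].
  by have /setP/(_ (a, b)) := eD; rewrite !in_setI abS' !andbT.
case: (boolP (edge a b)) => [|neab]; last first.
  by apply/idP/idP=> Dab;
    [have := orientations_arrow oD1 Dab | have := orientations_arrow oD2 Dab];
    case=> _ _; rewrite (negPf neab).
rewrite (pendant_edge pS aS bS) => /or3P[/and3P[aS' bS' _]|/eqP[-> ->]//|/eqP[-> ->]].
  by rewrite in_setX aS' bS' in abnS'.
by rewrite !evlD // elD.
Qed.

(** A rooted orientation determines its root and has no immorality, so at least
    [#|S|] orientations have none ([Z] below); these give only one pattern. *)
Lemma leq_patterns S : cycle_free G -> joined S -> 0 < #|S| ->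
  #|patterns S| <= 2 ^ #|S|.-1 - #|S| + 1.
Proof.
move=> cG jS S0; set O := orientations S.
pose Z := [set D in O | immoralities D == set0].
have ltZ : #|S| <= #|Z|.
  have /card_gt0P[r0 _] := S0.
  pose root D := odflt r0 [pick r in S | [forall y, (y, r) \notin D]].
  apply: leq_trans (leq_imset_card root _).
  apply: subset_leq_card; apply/subsetP=> r rS.
  have [D oD rtD] := exists_rooted_orientation cG jS S0 rS.
  apply/imsetP; exists D; first by rewrite inE oD (rooted_no_immorality rtD) /=.
  have [_ rD] := rtD; rewrite /root; case: pickP => [r' /andP[r'S /forallP nD]|/(_ r)] /=.
    case: (eqVneq r r') => // rr'; have := rD r'.
    rewrite !inE r'S eq_sym rr' => /existsP[y Dy].
    by have := nD y; rewrite Dy.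
  rewrite rS /= => /forallP[] y; have := rD r; rewrite !inE eqxx /= => /existsPn.
  exact.
have sZ : Z \subset O by apply/subsetP=> D; rewrite inE => /andP[].
have leO := leq_orientations cG jS S0.
apply: leq_trans (_ : #|set0 |: @immoralities G @: (O :\: Z)| <= _).
  apply: subset_leq_card; apply/subsetP=> _ /imsetP[D oD ->].
  rewrite in_setU1; case: (boolP (immoralities D == set0)) => //= nD.
  by apply: imset_f; rewrite in_setD in_set (negPf nD) andbF.
rewrite cardsU1 addnC; apply: leq_add; last by case: (_ \notin _).
apply: leq_trans (leq_imset_card _ _) _.
by rewrite cardsD (setIidPr sZ); apply: leq_sub.
Qed.

End Counting.

(** * Paths and stars *)

(** A vertex of maximal rank on a cycle would have two distinct neighbours of
    no larger rank. *)
Lemma cycle_free_of_rank (G : sgraph) (f : G -> nat) :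
  (forall x y z : G, edge x y -> edge x z -> f y <= f x -> f z <= f x -> y = z) ->
  cycle_free G.
Proof.
move=> fP c c2 /andP[cc Uc]; case: c => [//|x0 c'] in c2 cc Uc *.
set c := x0 :: c' in c2 cc Uc.
have [x xc max] := arg_maxnP f (mem_head x0 c' : [pred z in c] x0).
have [i s rE] := rot_to xc.
have {}max y : y \in s -> f y <= f x.
  by move=> ys; apply: max; rewrite inE -(mem_rot i) rE inE ys orbT.
move: c2 cc Uc; rewrite -(size_rot i c) -(rot_cycle i) -(rot_uniq i) rE.
case: s max {rE} => [|y s] max //=; case/lastP: s max => [|s z] //= max _.
rewrite rcons_path last_rcons => /andP[exy /andP[_ ezx]] /and3P[_ + _].
case/negP; rewrite (fP x y z) ?mem_rcons ?mem_head //.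
- by rewrite edge_sym.
- by apply: max; rewrite mem_head.
by apply: max; rewrite inE mem_rcons mem_head orbT.
Qed.

Lemma cycle_free_path p : cycle_free (path_graph p).
Proof.
apply: (@cycle_free_of_rank (path_graph p) (@nat_of_ord p)) => x y z.
by rewrite /= /path_rel /= => exy exz lyx lzx; apply: ord_inj; lia.
Qed.

Lemma card_patterns_path p k : k < p ->
  #|patterns [set i : path_graph p | (i : 'I_p) <= k]| = fib k.
Proof.
have [m] := ubnP k; elim: m k => // m IHm k ltkm ltkp.
case: k => [|[|k]] in ltkm ltkp *;
  try (apply: patterns_eq1 => x y z; rewrite !inE /= /path_rel /= => *;
       apply: ord_inj; lia).
pose l : path_graph p := Ordinal ltkp.
pose v : path_graph p := Ordinal (ltnW ltkp).
pose u : path_graph p := Ordinal (ltnW (ltnW ltkp)).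
have delS j (x : path_graph p) : nat_of_ord (x : 'I_p) = j.+1 ->
    [set i : path_graph p | (i : 'I_p) <= j.+1] :\ x =
    [set i : path_graph p | (i : 'I_p) <= j].
  by move=> xj; apply/setP=> i; rewrite !inE -(inj_eq val_inj) /= xj; lia.
have pS : pendant [set i : path_graph p | (i : 'I_p) <= k.+2] l v.
  split; rewrite ?inE //= /path_rel /=; first by lia.
  by move=> w; rewrite !inE /= => *; apply: ord_inj => /=; lia.
have pS' : pendant ([set i : path_graph p | (i : 'I_p) <= k.+2] :\ l) v u.
  rewrite delS //; split; rewrite ?inE //= /path_rel /=; first by lia.
  by move=> w; rewrite !inE /= => *; apply: ord_inj => /=; lia.
by rewrite (patterns_pendant_path pS pS') !delS // !IHm //; lia.
Qed.

Lemma M_path p : 0 < p -> M (path_graph p) = fib p.-1.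
Proof.
case: p => // p _; rewrite (M_patterns (@cycle_free_path _)).
rewrite -(card_patterns_path (ltnSn p)); congr #|patterns _|.
by apply/setP=> i; rewrite !inE -ltnS ltn_ord.
Qed.

Lemma tree_star q : tree (star_graph q).
Proof.
split; last first.
  apply: (@cycle_free_of_rank (star_graph q) (@nat_of_ord q.+1)) => x y z.
  rewrite /= /star_rel /= -!(inj_eq val_inj) /=.
  by move=> exy exz lyx lzx; apply: ord_inj; lia.
have c0 x : connect (@edge (star_graph q)) x ord0.
  case: (eqVneq x ord0) => [->|x0]; first exact: connect0.
  by apply: connect1; rewrite /= /star_rel /= x0 eqxx orbT.
move=> x y; apply: connect_trans (c0 x) _.
by rewrite (sym_connect_sym (@edge_sym (star_graph q))).
Qed.

Section Star.
Variable q : nat.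
Let G := star_graph q.
Let center : G := ord0.

Definition star_orientation (A : {set G}) : {set G * G} :=
  [set t : G * G | edge t.1 t.2 &&
     (if t.2 == center then t.1 \in A else t.2 \notin A)].

Lemma star_orientationP A : star_orientation A \in orientations [set: G].
Proof.
apply/orientationsP; split=> x y; rewrite /skeleton /= /arrow /= !inE /= /star_rel /=.
  rewrite -[ord0]/center [y == x]eq_sym.
  case: (eqVneq x center) => [->|xc]; case: (eqVneq y center) => [->|yc];
    rewrite ?eqxx ?andbF //= ?(negPf xc) ?(negPf yc) ?andbF ?orbF ?andbT //=.
    by case: (y \in A); rewrite ?andbF ?andbT ?orbF.
  by case: (x \in A); rewrite ?andbF ?andbT ?orbF.
rewrite -[ord0]/center.
case: (eqVneq x center) => [->|xc]; case: (eqVneq y center) => [->|yc];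
  rewrite ?eqxx ?andbF //= ?(negPf xc) ?(negPf yc) ?andbF //=.
by case: (x \in A); rewrite ?andbF.
Qed.

(** If [A] is not a singleton, each leaf pointing to the centre collides there
    with another one, so that the pattern determines [A]. *)
Lemma star_immorality (A : {set G}) a : A \subset [set~ center] -> #|A| != 1 ->
  (a \in A) = [exists k, (a, center, k) \in immoralities (star_orientation A)].
Proof.
move=> sA A1; apply/idP/existsP=> [aA|[k]]; last first.
  by rewrite immoralitiesE !inE /= => /andP[/andP[]].
have nc x : x \in A -> x != center by move/(subsetP sA); rewrite !inE.
have eA x : x \in A -> (x, center) \in star_orientation A.
  by move=> xA; rewrite !inE /= xA /star_rel /= orbT nc.
have /card_gt0P[k /setD1P[ka kA]] : 0 < #|A :\ a|.
  by move: A1; rewrite (cardsD1 a) aA; case: #|A :\ a|.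
exists k; rewrite immoralitiesE !eA //= eq_sym ka /=.
have [-> _] := orientationsP _ _ (star_orientationP A).
by rewrite /= /star_rel /= (negPf (nc a aA)) (negPf (nc k kA)) !andbF.
Qed.

Lemma leq_patterns_star : 2 ^ q - q <= #|patterns [set: G]|.
Proof.
pose C := [set~ center].
have cC : #|C| = q.
  by rewrite cardsC1 card_ord.
pose F := powerset C :\: [set A : {set G} | A \subset C & #|A| == 1].
have cF : #|F| = 2 ^ q - q.
  rewrite cardsD (setIidPr _); last by apply/subsetP=> A; rewrite !inE => /andP[].
  by rewrite card_powerset cards_draws cC bin1.
rewrite -cF -(@card_in_imset _ _ (fun A => immoralities (star_orientation A))).
  apply: subset_leq_card; apply/subsetP=> _ /imsetP[A _ ->].
  exact/imset_f/star_orientationP.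
move=> A1 A2; rewrite !inE => /andP[n1 s1] /andP[n2 s2] E.
rewrite s1 in n1; rewrite s2 in n2.
by apply/setP=> a; rewrite !star_immorality // E.
Qed.

End Star.

Lemma leq_M_tree (T : sgraph) : tree T -> 0 < #|T| ->
  M T <= 2 ^ #|T|.-1 - #|T| + 1.
Proof.
move=> [cT fT] T0; rewrite (M_patterns fT) -cardsT in T0 *.
exact: leq_patterns fT (joined_setT cT) T0.
Qed.

Lemma M_star q : M (star_graph q) = 2 ^ q - q.
Proof.
have sT := tree_star q; apply/eqP; rewrite eqn_leq.
rewrite [X in _ && (_ <= X)]M_patterns ?leq_patterns_star ?andbT; last by case: sT.
have cT : #|star_graph q| = q.+1 by rewrite card_ord.
have := leq_M_tree sT; rewrite cT /= => /(_ isT) le.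
apply: leq_trans le _; have := ltn_expl q (ltnSn 1); lia.
Qed.

Theorem theorem3p1 (p : nat) (T : sgraph) :
  1 <= p -> tree T -> #|vertex T| = p ->
  [/\ fib p.-1 = M (path_graph p),
      M (path_graph p) <= M T,
      M T <= M (star_graph p.-1)
    & M (star_graph p.-1) = 2 ^ p.-1 - p + 1].
Proof.
move=> p0 tT cT; have [jT fT] := tT.
have starE : M (star_graph p.-1) = 2 ^ p.-1 - p + 1.
  rewrite M_star; case: p p0 {cT} => // p _ /=.
  by have := ltn_expl p (ltnSn 1); lia.
split=> //; first by rewrite M_path.
  rewrite M_path // (M_patterns fT); apply: fib_leq_patterns => //.
    exact: joined_setT.
  by rewrite cardsT cT prednK.
by rewrite starE -cT leq_M_tree // cT.
Qed.
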